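(* For all natural numbers $n$, $$\beta(Q_{n\times n})=\begin{cases}2k & \text{if } n=4k,\\ 2k+1 & \text{if } n=4k+1,\\ 2k+1 & \text{if } n=4k+2,\\ 2k+1 & \text{if } n=4k+3,\end{cases}$$ where $k$ denotes a nonnegative integer.
   Context: Natural numbers are positive integers. The squares (cells) of the $n\times n$ chessboard are $V(Q_{n\times n})=\{(x,y): 0\le x,y\le n-1\}$, with $x$ the column number and $y$ the row number. A column is a set of all cells with a fixed $x$; a row is a set of all cells with a fixed $y$; a sum diagonal is a (nonempty) set of all cells with a fixed value of $x+y$; a difference diagonal is a (nonempty) set of all cells with a fixed value of $x-y$. $\beta(Q_{n\times n})$ (Relaxed Queen's Domination) is the least number $p$ such that there exist rows $R_0,\dots,R_{p-1}$, columns $C_0,\dots,C_{p-1}$, sum diagonals $S_0,\dots,S_{p-1}$ and difference diagonals $D_0,\dots,D_{p-1}$ (repetitions allowed) with $V(Q_{n\times n})=\bigcup_i R_i\cup\bigcup_i C_i\cup\bigcup_i S_i\cup\bigcup_i D_i$. *)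

(* Defs.v *)
From mathcomp Require Import all_boot all_order all_algebra.

Set Implicit Arguments.
Unset Strict Implicit.
Unset Printing Implicit Defensive.

Import GRing.Theory.

Local Open Scope nat_scope.

(* A cell is a pair (x, y): column number x, row number y. *)
Definition cell (n : nat) : finType := ('I_n * 'I_n)%type.

Definition col_line (n : nat) (a : 'I_n) : {set cell n} :=
  [set c : cell n | c.1 == a].
Definition row_line (n : nat) (b : 'I_n) : {set cell n} :=
  [set c : cell n | c.2 == b].
Definition sum_diag (n s : nat) : {set cell n} :=
  [set c : cell n | c.1 + c.2 == s].
Definition diff_diag (n : nat) (d : int) : {set cell n} :=
  [set c : cell n | (c.1%:Z - c.2%:Z)%R == d].

Definition columns (n : nat) : {set {set cell n}} := [set col_line a | a : 'I_n].
Definition rows (n : nat) : {set {set cell n}} := [set row_line b | b : 'I_n].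

(* Only nonempty diagonals count; ranging over the diagonals through the cells
   of the board yields exactly these (sum_diagsP and diff_diagsP below) and
   keeps the families finite. *)
Definition sum_diags (n : nat) : {set {set cell n}} :=
  [set sum_diag n (c.1 + c.2) | c : cell n].
Definition diff_diags (n : nat) : {set {set cell n}} :=
  [set diff_diag n (c.1%:Z - c.2%:Z)%R | c : cell n].

Lemma sum_diagsP (n : nat) (A : {set cell n}) :
  reflect (A != set0 /\ exists s : nat, A = sum_diag n s) (A \in sum_diags n).
Proof.
apply: (iffP imsetP) => [[c _ ->]|[/set0Pn[c cA] [s defA]]].
  by split; [apply/set0Pn; exists c; rewrite inE | eexists].
by exists c => //; move: cA; rewrite defA inE => /eqP ->.
Qed.

Lemma diff_diagsP (n : nat) (A : {set cell n}) :
  reflect (A != set0 /\ exists d : int, A = diff_diag n d) (A \in diff_diags n).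
Proof.
apply: (iffP imsetP) => [[c _ ->]|[/set0Pn[c cA] [d defA]]].
  by split; [apply/set0Pn; exists c; rewrite inE | eexists].
by exists c => //; move: cA; rewrite defA inE => /eqP ->.
Qed.

(* The families indexed by 'I_p need not be injective: repetitions allowed. *)
Definition relaxed_cover (n p : nat) : bool :=
  [exists R : {ffun 'I_p -> {set cell n}},
   exists C : {ffun 'I_p -> {set cell n}},
   exists S : {ffun 'I_p -> {set cell n}},
   exists D : {ffun 'I_p -> {set cell n}},
   [&& [forall i, R i \in rows n],
       [forall i, C i \in columns n],
       [forall i, S i \in sum_diags n],
       [forall i, D i \in diff_diags n]
     & [set: cell n] == (\bigcup_i R i) :|: (\bigcup_i C i)
                        :|: (\bigcup_i S i) :|: (\bigcup_i D i)]].

Lemma relaxed_cover_ex (n : nat) : exists p : nat, relaxed_cover n p.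
Proof.
exists n.
apply/existsP; exists [ffun i => row_line i].
apply/existsP; exists [ffun i => col_line i].
apply/existsP; exists [ffun i : 'I_n => sum_diag n (i + i)].
apply/existsP.
exists [ffun i : 'I_n => diff_diag n (i%:Z - i%:Z)%R].
apply/and5P; split; try (apply/forallP => i; rewrite ffunE).
- exact: imset_f.
- exact: imset_f.
- by apply/imsetP; exists (i, i).
- by apply/imsetP; exists (i, i).
rewrite eq_sym -subTset; apply/subsetP => c _; rewrite !inE.
suff -> : c \in \bigcup_i [ffun i => row_line i] i by [].
by apply/bigcupP; exists c.2; rewrite // ffunE inE.
Qed.

Definition beta (n : nat) : nat := ex_minn (relaxed_cover_ex n).

(* Main.v *)
Require Import Defs.
From mathcomp Require Import all_boot all_order all_algebra.
From mathcomp Require Import zify.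

Local Open Scope nat_scope.

(** Lower bound.  Suppose [p] lines of each kind cover the board and [p < n].
    At least [n - p] columns and [n - p] rows are unoccupied; let [a], [b] be
    the extreme unoccupied columns and [c], [d] the extreme unoccupied rows.
    The cells where an unoccupied row meets column [a] must be covered
    diagonally, each by its own diagonal, and since they lie in the box
    [a, b] x [c, d] those diagonals satisfy a one-sided bound (sum at most
    [a + d], difference [y - x] at least [c - a]).  The other three sides of the
    box give analogous inequalities ([edge_count]).  If the box is wider than it
    is high, the diagonals serving its left and right sides are distinct, so
    [2 (n - p) <= 2 p]; a higher box is treated with its bottom and top sides.
    If the box is a square, a diagonal can serve two opposite sides only when
    it is a main diagonal of the box, and adding all four inequalities gives
    [4 (n - p) <= 4 (p + 1)].  So [n <= 2 p + 1] always.  When [n = 2 p + 1],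
    every inequality is tight: comparing the left and bottom sides, there are
    as many difference diagonals above the main one as below it, so their
    number [p], which includes the main one, is odd ([cover_bound]).  This
    parity constraint is what excludes [p = 2 k] for [n = 4 k + 1].

    Upper bound.  Occupy every odd row and column.  The remaining cells are
    [(2 i, 2 j)] with [i, j <= q] for [q = (n - 1) / 2], and they satisfy
    [|i + j - q| + |i - j| <= q].  So one of the two terms is at most [q / 2],
    and the [2 (q / 2) + 1] middle even diagonals of each direction suffice
    ([relaxed_cover_construction]). *)

(** * Covers in coordinates *)

(** The difference diagonal through [(x, y)] is recorded by [y + n - x], a
    shift of [y - x] that stays a natural number on the board. *)
Definition covers (n : nat) (cs rs ss ds : seq nat) : Prop :=
  forall x y, x < n -> y < n ->
    [|| x \in cs, y \in rs, x + y \in ss | y + n - x \in ds].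

Lemma codom_undup (p : nat) (f : 'I_p -> nat) :
  [/\ uniq (undup (codom f)), size (undup (codom f)) <= p
    & forall i, f i \in undup (codom f)].
Proof.
split; first exact: undup_uniq.
  by rewrite (leq_trans (size_undup _)) // size_codom card_ord.
by move=> i; rewrite mem_undup codom_f.
Qed.

Lemma relaxed_cover_covers (n p : nat) : relaxed_cover n p ->
  exists cs rs ss ds : seq nat,
    [/\ size cs <= p, size rs <= p, uniq ss /\ size ss <= p,
        uniq ds /\ size ds <= p & covers n cs rs ss ds].
Proof.
case/existsP=> R /existsP[C /existsP[S /existsP[D]]].
case/and5P=> /forallP hR /forallP hC /forallP hS /forallP hD /eqP cov.
have /fin_all_exists[r Er] i : exists b : 'I_n, R i = row_line b.
  by have /imsetP[b _ ->] := hR i; exists b.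
have /fin_all_exists[c Ec] i : exists b : 'I_n, C i = col_line b.
  by have /imsetP[b _ ->] := hC i; exists b.
have /fin_all_exists[s Es] i : exists b : cell n, S i = sum_diag n (b.1 + b.2).
  by have /imsetP[b _ ->] := hS i; exists b.
have /fin_all_exists[d Ed] i :
    exists b : cell n, D i = diff_diag n (b.1%:Z - b.2%:Z)%R.
  by have /imsetP[b _ ->] := hD i; exists b.
have [_ szc inc] := codom_undup p (fun i => c i : nat).
have [_ szr inr] := codom_undup p (fun i => r i : nat).
have [us szs ins] := codom_undup p (fun i => (s i).1 + (s i).2).
have [ud szd ind] := codom_undup p (fun i => (d i).2 + n - (d i).1).
do 4!eexists; split; [exact: szc|exact: szr|split; [exact: us|exact: szs]
  |split; [exact: ud|exact: szd]|].
move=> x y ltxn ltyn.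
have : (Ordinal ltxn, Ordinal ltyn) \in [set: cell n] by rewrite inE.
rewrite cov !in_setU => /orP[/orP[/orP[]|]|] /bigcupP[i _].
- by rewrite Er inE => /eqP/(congr1 val) /= ->; rewrite inr !orbT.
- by rewrite Ec inE => /eqP/(congr1 val) /= ->; rewrite inc.
- by rewrite Es inE => /eqP /= ->; rewrite ins !orbT.
rewrite Ed inE => /eqP /= E.
have -> : y + n - x = (d i).2 + n - (d i).1.
  by case: (d i) E => u v /= E; have := ltn_ord u; lia.
by rewrite ind !orbT.
Qed.

Lemma covers_relaxed_cover (n p : nat) (cs rs ss ds : seq nat) : 0 < n ->
  size cs <= p -> size rs <= p -> size ss <= p -> size ds <= p ->
  (forall s : nat, s \in ss -> s <= (n - 1) + (n - 1)) ->
  (forall d : nat, d \in ds -> 0 < d < n + n) ->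
  covers n cs rs ss ds -> relaxed_cover n p.
Proof.
case: n => // n _ szc szr szs szd bs bd cov.
have pad (l : seq nat) (z z0 : nat) : size l <= p -> z \in l ->
    exists i : 'I_p, nth z0 l i = z.
  move=> szl zl; have ltz : index z l < p.
    by apply: leq_trans szl; rewrite index_mem.
  by exists (Ordinal ltz); rewrite /= nth_index.
(* The defaults 0 and n.+1 are the codes of the diagonals through (0, 0):
   padding a list that is too short still yields nonempty diagonals. *)
apply/existsP; exists [ffun i : 'I_p => row_line (inord (nth 0 rs i) : 'I_n.+1)].
apply/existsP; exists [ffun i : 'I_p => col_line (inord (nth 0 cs i) : 'I_n.+1)].
apply/existsP; exists [ffun i : 'I_p => sum_diag n.+1 (nth 0 ss i)].
apply/existsP; exists [ffun i : 'I_p =>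
  diff_diag n.+1 (n.+1%:Z - (nth n.+1 ds i)%:Z)%R].
apply/and5P; split; try (apply/forallP => i; rewrite ffunE).
- exact: imset_f.
- exact: imset_f.
- have les : nth 0 ss i <= n + n.
    have [lt|ge] := ltnP i (size ss); last by rewrite nth_default.
    by have /bs := mem_nth 0 lt; rewrite subSS subn0.
  apply/imsetP.
  exists (inord (minn n (nth 0 ss i)),
          inord (nth 0 ss i - minn n (nth 0 ss i))) => //.
  by rewrite /= !inordK; [congr sum_diag|..]; lia.
- have led : 0 < nth n.+1 ds i < n.+1 + n.+1.
    have [lt|ge] := ltnP i (size ds); last by rewrite nth_default //; lia.
    exact: bd (mem_nth _ lt).
  apply/imsetP.
  exists (inord (n.+1 - nth n.+1 ds i), inord (nth n.+1 ds i - n.+1)) => //.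
  by rewrite /= !inordK; [congr diff_diag|..]; lia.
rewrite eq_sym -subTset; apply/subsetP => [[x y]] _; rewrite !in_setU.
case/or4P: (cov x y (ltn_ord x) (ltn_ord y)) => /pad.
- case/(_ 0 szc) => i E; apply/orP; left; apply/orP; left; apply/orP; right.
  by apply/bigcupP; exists i; rewrite // ffunE inE /= E inord_val.
- case/(_ 0 szr) => i E; apply/orP; left; apply/orP; left; apply/orP; left.
  by apply/bigcupP; exists i; rewrite // ffunE inE /= E inord_val.
- case/(_ 0 szs) => i E; apply/orP; left; apply/orP; right.
  by apply/bigcupP; exists i; rewrite // ffunE inE /= E.
case/(_ n.+1 szd) => i E; apply/orP; right.
apply/bigcupP; exists i; rewrite // ffunE inE /= E; apply/eqP.
by have := ltn_ord x; lia.
Qed.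

(** * The lower bound *)

Lemma exists_extremes (U : seq nat) : 0 < size U ->
  exists a b, [/\ a \in U, b \in U & forall x, x \in U -> a <= x <= b].
Proof.
elim: U => // z U IH _; have [/IH[a [b [aU bU ab]]]|] := ltnP 0 (size U).
  exists (minn z a), (maxn z b); split.
  - by rewrite /minn; case: ifP => _; rewrite !inE ?eqxx ?aU ?orbT.
  - by rewrite /maxn; case: ifP => _; rewrite !inE ?eqxx ?bU ?orbT.
  by move=> x; rewrite inE => /orP[/eqP->|/ab]; lia.
case: U {IH} => // _; exists z, z; split; rewrite ?mem_head // => x.
by rewrite inE => /eqP->; rewrite leqnn.
Qed.

Definition free_lines (n : nat) (ls : seq nat) : seq nat :=
  [seq x <- iota 0 n | x \notin ls].

Lemma mem_free_lines (n x : nat) (ls : seq nat) :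
  (x \in free_lines n ls) = (x \notin ls) && (x < n).
Proof. by rewrite mem_filter mem_iota add0n. Qed.

Lemma size_free_lines (n : nat) (ls : seq nat) :
  n - size ls <= size (free_lines n ls).
Proof.
have := count_predC (mem ls) (iota 0 n); rewrite size_iota.
have : count (mem ls) (iota 0 n) <= size ls.
  rewrite -size_filter uniq_leq_size ?filter_uniq ?iota_uniq // => x.
  by rewrite mem_filter => /andP[].
by rewrite size_filter; have -> : count (predC (mem ls)) (iota 0 n)
  = count (fun x => x \notin ls) (iota 0 n) by []; lia.
Qed.

(** Along one side of the box a diagonal determines the cell where it meets
    that side ([f] for sum diagonals, [g] for difference diagonals), so the
    cells of the side are at most as many as the diagonals reaching it. *)
Lemma edge_count (U ss ds : seq nat) (P Q : pred nat) (f g : nat -> nat) :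
    uniq U ->
    (forall z, z \in U -> (exists2 s, s \in ss & P s /\ z = f s) \/
                          (exists2 d, d \in ds & Q d /\ z = g d)) ->
  size U <= count P ss + count Q ds.
Proof.
move=> uU H; rewrite -!size_filter -(size_map f (filter P ss)) -(size_map g (filter Q ds)).
rewrite -size_cat; apply: uniq_leq_size => // z /H; rewrite mem_cat.
case=> [[s sS [Ps ->]]|[d dD [Qd ->]]]; apply/orP; [left|right];
  by apply: map_f; rewrite mem_filter ?Ps ?Qd.
Qed.

Lemma count_disjoint_rays (t u : nat) (s : seq nat) : t < u ->
  count (fun z => z <= t) s + count (fun z => u <= z) s <= size s.
Proof. by move=> ltu; elim: s => //= z s; lia. Qed.

(** The shared endpoint [t], which will be a main diagonal of a square box, is
    counted twice but occurs at most once in [s]. *)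
Lemma count_adjacent_rays (t : nat) (s : seq nat) : uniq s ->
  exists e, e <= 1 /\
    count (fun z => z <= t) s + count (fun z => t <= z) s = size s + e.
Proof.
move=> us; exists (count_mem t s); split; first by rewrite count_uniq_mem ?leq_b1.
by elim: s {us} => //= z s; case: eqP; lia.
Qed.

(** The parity clause comes from the square box: tightness on the left and
    bottom sides forces equally many difference diagonals on either side of the
    main one. *)
Lemma cover_bound (n p : nat) (cs rs ss ds : seq nat) :
    size cs <= p -> size rs <= p -> uniq ss -> size ss <= p ->
    uniq ds -> size ds <= p -> covers n cs rs ss ds ->
  n <= 2 * p + 1 /\ (n = 2 * p + 1 -> odd p).
Proof.
move=> szc szr us szs ud szd cov.
have [ltpn|] := ltnP p n; last by lia.
have szX := size_free_lines n cs; have szY := size_free_lines n rs.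
have [|a [b [aX bX ab]]] := exists_extremes (free_lines n cs); first by lia.
have [|c [d [cY dY cd]]] := exists_extremes (free_lines n rs); first by lia.
have diag x y : x \in free_lines n cs -> y \in free_lines n rs ->
    (x + y \in ss) \/ (y + n - x \in ds).
  rewrite !mem_free_lines => /andP[/negPf xc ltx] /andP[/negPf yr lty].
  by have := cov x y ltx lty; rewrite xc yr /= => /orP.
have uX : uniq (free_lines n cs) by rewrite filter_uniq ?iota_uniq.
have uY : uniq (free_lines n rs) by rewrite filter_uniq ?iota_uniq.
have ltX x : x \in free_lines n cs -> x < n.
  by rewrite mem_free_lines => /andP[].
have ltan := ltX _ aX; have ltbn := ltX _ bX.
have left : size (free_lines n rs) <= count (fun s => s <= a + d) ss
                                    + count (fun t => c + n - a <= t) ds.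
  apply: (edge_count _ _ _ _ _ (fun s => s - a) (fun t => t + a - n)) => // y yY.
  have /andP[cy yd] := cd _ yY.
  by case: (diag a y aX yY) => m; [left|right]; eexists; try exact: m; lia.
have right : size (free_lines n rs) <= count (fun s => b + c <= s) ss
                                     + count (fun t => t <= d + n - b) ds.
  apply: (edge_count _ _ _ _ _ (fun s => s - b) (fun t => t + b - n)) => // y yY.
  have /andP[cy yd] := cd _ yY.
  by case: (diag b y bX yY) => m; [left|right]; eexists; try exact: m; lia.
have bottom : size (free_lines n cs) <= count (fun s => s <= b + c) ss
                                      + count (fun t => t <= c + n - a) ds.
  apply: (edge_count _ _ _ _ _ (fun s => s - c) (fun t => c + n - t)) => // x xX.
  have /andP[ax xb] := ab _ xX; have ltx := ltX _ xX.
  by case: (diag x c xX cY) => m; [left|right]; eexists; try exact: m; lia.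
have top : size (free_lines n cs) <= count (fun s => a + d <= s) ss
                                   + count (fun t => d + n - b <= t) ds.
  apply: (edge_count _ _ _ _ _ (fun s => s - d) (fun t => d + n - t)) => // x xX.
  have /andP[ax xb] := ab _ xX; have ltx := ltX _ xX.
  by case: (diag x d xX dY) => m; [left|right]; eexists; try exact: m; lia.
have [wide|high|square] := ltngtP (a + d) (b + c).
- have := count_disjoint_rays _ _ ss wide.
  have /(count_disjoint_rays _ _ ds) : d + n - b < c + n - a by lia.
  lia.
- have := count_disjoint_rays _ _ ss high.
  have /(count_disjoint_rays _ _ ds) : c + n - a < d + n - b by lia.
  lia.
have Ediff : d + n - b = c + n - a by lia.
rewrite -square Ediff in left right bottom top.
have [e [le1e Ee]] := count_adjacent_rays (a + d) ss us.
have [e' [le1e' Ee']] := count_adjacent_rays (c + n - a) ds ud.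
lia.
Qed.

Lemma relaxed_cover_bound (n p : nat) : relaxed_cover n p ->
  n <= 2 * p + 1 /\ (n = 2 * p + 1 -> odd p).
Proof.
case/relaxed_cover_covers=> cs [rs [ss [ds [szc szr [us szs] [ud szd] cov]]]].
exact: cover_bound cov.
Qed.

(** * The construction *)

(** The odd lines, and the [2 e + 1] middle even diagonals of each direction
    for [e = q / 2]; the even cells left over satisfy
    [|i + j - q| + |i - j| <= q < 2 (e + 1)]. *)
Lemma relaxed_cover_construction (n p : nat) : 0 < n ->
  n./2 <= p -> 2 * ((n - 1)./2)./2 + 1 <= p -> relaxed_cover n p.
Proof.
move=> n0 hn hp; set q := (n - 1)./2 in hp *; set e := q./2 in hp *.
have hq : q = (n - 1)./2 by []; have he : e = q./2 by [].
pose odds := [seq 2 * i + 1 | i <- iota 0 n./2].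
pose sums := [seq 2 * i | i <- iota (q - e) (2 * e + 1)].
pose diffs := [seq 2 * i + n - 2 * e | i <- iota 0 (2 * e + 1)].
have in_odds x : x < n -> odd x -> x \in odds.
  move=> ltx ox; apply/mapP; exists x./2; last by lia.
  by rewrite mem_iota; lia.
apply: (covers_relaxed_cover n p odds odds sums diffs);
  rewrite ?size_map ?size_iota //.
- by move=> s /mapP[i]; rewrite mem_iota; lia.
- by move=> s /mapP[i]; rewrite mem_iota; lia.
move=> x y ltx lty.
have [ox|ex] := boolP (odd x); first by rewrite in_odds.
have [oy|ey] := boolP (odd y); first by rewrite (in_odds y) ?orbT.
have [in_sums|out] := boolP (q - e <= x./2 + y./2 <= q + e).
  apply/or4P/Or43/mapP; exists (x./2 + y./2); last by lia.
  by rewrite mem_iota; lia.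
apply/or4P/Or44/mapP; exists (y./2 + e - x./2); last by lia.
by rewrite mem_iota; lia.
Qed.

Lemma beta_eq (n p : nat) : 0 < n ->
    n./2 <= p -> 2 * ((n - 1)./2)./2 + 1 <= p ->
    (forall m, n <= 2 * m + 1 -> (n = 2 * m + 1 -> odd m) -> p <= m) ->
  beta n = p.
Proof.
move=> n0 hn hp low; rewrite /beta; case: ex_minnP => m cov min.
apply/eqP; rewrite eqn_leq min ?relaxed_cover_construction //.
by have [le_n odd_m] := relaxed_cover_bound _ _ cov; apply: low.
Qed.

Theorem theorem3p6 (n : nat) (hn : 0 < n) (k : nat) :
  [/\ n = 4 * k     -> beta n = 2 * k,
      n = 4 * k + 1 -> beta n = 2 * k + 1,
      n = 4 * k + 2 -> beta n = 2 * k + 1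
    & n = 4 * k + 3 -> beta n = 2 * k + 1].
Proof. by split=> En; apply: beta_eq; lia. Qed.
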